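(* Let $(y_i,p_i)$, $0\le i\le n$, be Hermite data and let $\tau_i=\frac{y_i-y_{i-1}}{h_i}$; assume $p_{i-1}<\tau_i<p_i$ for $1\le i\le n$. For a choice of parameters $\theta_i\in\,]0,\frac14]$, $1\le i\le n$, let $g\in GS_2(I,X,\beta)$, with $\beta_i=\frac{-2\theta_i}{1-2\theta_i}$, be the unique generalized quadratic spline with $g(x_i)=y_i$ and $g'(x_i)=p_i$ for $0\le i\le n$. Then for each $1\le i\le n$: (i) if $\frac14(3p_{i-1}+p_i)\le\tau_i\le\frac14(p_{i-1}+3p_i)$, then one can choose $\theta_i=\frac14$, i.e. with this choice $g$ is convex on $I_i$; in that case the local interpolant $g|_{I_i}$ is an ordinary quadratic spline; (ii) otherwise the local interpolant is a generalized quadratic spline with $\theta_i<\frac14$, namely: (a) if $p_{i-1}<\tau_i<\frac14(3p_{i-1}+p_i)$, one has to choose $\theta_i\le\bar\theta_i:=\frac{\tau_i-p_{i-1}}{p_i-p_{i-1}}$, i.e. $g$ is convex on $I_i$ if and only if $\theta_i\le\bar\theta_i$; (b) if $\frac14(p_{i-1}+3p_i)<\tau_i<p_i$, one has to choose $\theta_i\le\bar\theta_i:=\frac{p_i-\tau_i}{p_i-p_{i-1}}$, i.e. $g$ is convex on $I_i$ if and only if $\theta_i\le\bar\theta_i$. In both cases (a) and (b), the local interpolant belongs to $V(\beta_i)$ with $\beta_i=\frac{-2\theta_i}{1-2\theta_i}$.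
   Context: Setting. Let $n\ge 1$, $I=[a,b]$, $X=\{a=x_0<x_1<\dots<x_n=b\}$ a partition of $I$, $I_i=[x_{i-1},x_i]$, $h_i=x_i-x_{i-1}$ for $1\le i\le n$. Let $\beta=(\beta_1,\dots,\beta_n)$ with $\beta_i\in[-1,0[$ and $\theta_i=\frac12\frac{\beta_i}{\beta_i-1}\in\,]0,\frac14]$ (equivalently $\beta_i=\frac{-2\theta_i}{1-2\theta_i}$). The space $V(\beta_i)$ (generated by the Merrien subdivision algorithm) is the set of $C^1$ functions $f$ on $I_i$ such that for every dyadic subinterval $[u,v]$ of $I_i$ (i.e. every interval obtained from $I_i$ by repeated bisection, including $I_i$ itself), with $m=\frac12(u+v)$ and $h=v-u$, $$f(m)=\tfrac12\big(f(u)+f(v)-\theta_i h\,(f'(v)-f'(u))\big),\qquad f'(m)=\frac{1}{1-2\theta_i}\Big(\frac{f(v)-f(u)}{h}-2\theta_i\,\frac{f'(u)+f'(v)}{2}\Big).$$ It is known that for any prescribed values of $f,f'$ at the two endpoints of $I_i$ there is exactly one such $f$; so $\dim V(\beta_i)=4$. $GS_2(\beta)=GS_2(I,X,\beta)$ is the space of all $g\in C^1(I)$ with $g|_{I_i}\in V(\beta_i)$ for all $1\le i\le n$ (generalized quadratic splines). Each $g$ is uniquely determined by the Hermite data $g(x_i),g'(x_i)$, $0\le i\le n$, which can be prescribed arbitrarily. An ordinary quadratic spline on $I_i$ means a $C^1$ piecewise quadratic polynomial with a single knot at the midpoint of $I_i$ (this corresponds to $\theta_i=\frac14$, $\beta_i=-1$).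 *)

(* Defs.v *)
From HB Require Import structures.
From mathcomp Require Import all_boot all_order all_algebra.
From mathcomp Require Import all_classical all_reals all_analysis.

Set Implicit Arguments.
Unset Strict Implicit.
Unset Printing Implicit Defensive.

Import Order.TTheory GRing.Theory Num.Theory.
Import numFieldNormedType.Exports.

Local Open Scope classical_set_scope.
Local Open Scope ring_scope.

Section C1_on_a_set.
Context {R : realType}.
Implicit Types (A : set R) (f : R -> R) (x : R).

(* Difference quotients are taken along A only, so that on a closed interval
   the derivative at an endpoint is the one-sided one and the values of f
   outside A are irrelevant. *)
Definition derivable_within A f x : Prop :=
  cvg ((f t - f x) / (t - x) @[t --> within A x^']).

Definition derive_within A f x : R :=
  lim ((f t - f x) / (t - x) @[t --> within A x^']).

Definition C1_on A f : Prop :=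
  (forall x, A x -> derivable_within A f x) /\
  {within A, continuous (derive_within A f)}.

End C1_on_a_set.

Section merrien_space.
Context {R : realType}.
Implicit Types (u v beta theta : R) (f : R -> R).

Inductive dyadic_subinterval u v : R -> R -> Prop :=
| dyadic_self : dyadic_subinterval u v u v
| dyadic_left u' v' : dyadic_subinterval u v u' v' ->
    dyadic_subinterval u v u' ((u' + v') / 2)
| dyadic_right u' v' : dyadic_subinterval u v u' v' ->
    dyadic_subinterval u v ((u' + v') / 2) v'.

Definition theta_of_beta beta : R := 1 / 2 * (beta / (beta - 1)).

Definition beta_of_theta theta : R := - (2 * theta) / (1 - 2 * theta).

Definition merrien_space beta u v f : Prop :=
  let theta := theta_of_beta beta in
  let f' := derive_within `[u, v] f in
  C1_on `[u, v] f /\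
  forall u' v', dyadic_subinterval u v u' v' ->
    let m := (u' + v') / 2 in
    let h := v' - u' in
    f m = 1 / 2 * (f u' + f v' - theta * h * (f' v' - f' u')) /\
    f' m = 1 / (1 - 2 * theta) *
           ((f v' - f u') / h - 2 * theta * ((f' u' + f' v') / 2)).

Definition quadratic_spline u v f : Prop :=
  let m := (u + v) / 2 in
  C1_on `[u, v] f /\
  exists q r : {poly R},
    [/\ (size q <= 3)%N, (size r <= 3)%N,
        {in `[u, m], forall t, f t = q.[t]} &
        {in `[m, v], forall t, f t = r.[t]}].

End merrien_space.

Section generalized_quadratic_splines.
Context {R : realType} {n : nat}.
Implicit Types (a b : R) (x y : 'I_n.+1 -> R) (i : 'I_n).

(* Subintervals are numbered from 0: i : 'I_n stands for
   [x_i, x_(i+1)], with endpoints x (lnode i) and x (rnode i). *)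
Definition lnode i : 'I_n.+1 := widen_ord (leqnSn n) i.
Definition rnode i : 'I_n.+1 := lift ord0 i.

Definition is_partition a b x : Prop :=
  [/\ x ord0 = a, x ord_max = b & forall i, x (lnode i) < x (rnode i)].

Definition slope x y i : R :=
  (y (rnode i) - y (lnode i)) / (x (rnode i) - x (lnode i)).

Definition GS2 a b x (beta : 'I_n -> R) (g : R -> R) : Prop :=
  C1_on `[a, b] g /\
  forall i, merrien_space (beta i) (x (lnode i)) (x (rnode i)) g.

End generalized_quadratic_splines.

(* Main.v *)
Require Import Defs.
From HB Require Import structures.
From mathcomp Require Import all_boot all_order all_algebra.
From mathcomp Require Import all_classical all_reals all_analysis.
From mathcomp Require Import ring lra.

Set Implicit Arguments.
Unset Strict Implicit.
Unset Printing Implicit Defensive.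

Import Order.TTheory GRing.Theory Num.Theory.
Import numFieldNormedType.Exports.

Local Open Scope classical_set_scope.
Local Open Scope ring_scope.

(** Fix an interval of the partition, with end slopes [pl], [pr] and chord slope
    [tau]. The proof watches two numbers attached to every dyadic subinterval,
      [left_gap  = tau - pl - theta * (pr - pl)] and
      [right_gap = pr - tau - theta * (pr - pl)].
    The Merrien rule for the derivative at the midpoint [m] says precisely that
      [(1 - 2 * theta) * (f' m - pl) = left_gap] and
      [(1 - 2 * theta) * (pr - f' m) = right_gap]
    ([merrien_midpoint]): the gaps are, up to a positive factor, the increments
    of the derivative over the two halves. The rule for the value at [m] then
    makes the gaps evolve linearly and without interaction: both gaps of the
    left half are multiples of the parent's left gap, with coefficients
    [(1 - 3 * theta) / (1 - 2 * theta)] and [theta / (1 - 2 * theta)], and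
    symmetrically on the right ([merrien_gap_halving]).

    For [0 <= theta <= 1/3] these coefficients are nonnegative, so nonnegative
    gaps stay nonnegative at all scales. The derivative then increases along
    each bisection, hence, being continuous, everywhere
    ([nondecreasing_of_dyadic]); by the mean value theorem the function lies
    above its tangents and is convex. Conversely the tangents of a convex
    function at the two ends and at the midpoint force the derivative to
    increase there, that is, the gaps to be nonnegative. This is
    [merrien_convexP]: convexity amounts to
    [theta * (pr - pl) <= tau - pl] and [theta * (pr - pl) <= pr - tau].
    At [theta = 1/4] this places [tau] in the middle half of [[pl, pr]]. When
    [tau] lies in one of the outer quarters, the inequality for the farther end
    holds automatically for [theta <= 1/4], and the other one is the stated
    bound on [theta].

    At [theta = 1/4] the two coefficients are equal, so on each half the two
    gaps agree: the chord slope is the mean of the end slopes. Some quadratic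
    polynomial therefore matches the four Hermite data of the half; quadratics
    obey the Merrien rules for [theta = 1/4], so the match persists at all
    dyadic points and extends to the whole half by continuity
    ([merrien_quarter_quadratic]). *)

(** * Derivatives along a closed interval *)

(** Approaching [s] along the segment towards [t] stays inside the interval.
    This makes the filter that defines [derive_within] proper, and lets its
    limit be computed along a segment, on which convexity speaks. *)
Lemma cvg_segment_within (R : realType) (u v s t : R) :
  s \in `[u, v] -> t \in `[u, v] -> t != s ->
  s + h * (t - s) @[h --> 0^'+] --> within `[u, v] s^'.
Proof.
rewrite !in_itv /= => /andP[us sv] /andP[ut tv] ts P.
have ts0 : 0 < `|t - s| by rewrite normr_gt0 subr_eq0.
move=> /nbhs_ballP[e /= e0 Pe].
suff: \forall h \near (0 : R)^'+, P (s + h * (t - s)) by [].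
near=> h.
have h0 : 0 < h by near: h; exact: nbhs_right_gt.
have h1 : h < 1 by near: h; exact: nbhs_right_lt.
apply: Pe => /=.
- rewrite /ball /= opprD addrA subrr sub0r normrN normrM gtr0_norm //.
  rewrite -ltr_pdivlMr //; near: h.
  by apply: nbhs_right_lt; rewrite divr_gt0.
- by rewrite -subr_eq0 addrAC subrr add0r mulf_eq0 negb_or subr_eq0 ts gt_eqF.
- by rewrite in_itv /=; apply/andP; split; nra.
Unshelve. all: by end_near. Qed.

Lemma within_itv_dnbhs_proper (R : realType) (u v s : R) :
  u < v -> s \in `[u, v] -> ProperFilter (within `[u, v] s^').
Proof.
move=> uv suv.
have [t tuv ts] : exists2 t, t \in `[u, v] & t != s.
  have [->|su] := eqVneq s u.
    by exists v; [rewrite in_itv /= lexx (ltW uv)|rewrite gt_eqF].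
  by exists u; [rewrite in_itv /= lexx (ltW uv)|rewrite eq_sym].
split; last exact: within_filter.
by move=> /(cvg_segment_within suv tuv ts) /filter_not_empty.
Qed.

(** A one-sided derivative at an end of a subinterval is a limit of the same
    quotients along a smaller set, and limits are unique there because
    [within_itv_dnbhs_proper] makes the smaller filter proper. *)
Lemma derive_within_subset (R : realType) (A : set R) (f : R -> R) (u v s : R) :
  u < v -> s \in `[u, v] -> `[u, v] `<=` A -> derivable_within A f s ->
  derive_within `[u, v] f s = derive_within A f s.
Proof.
move=> uv suv sA fs.
have pF := within_itv_dnbhs_proper uv suv.
apply: cvg_lim => //; apply: cvg_trans fs.
by apply: cvg_app; apply: within_subset.
Qed.

Lemma derivable_within_continuous (R : realType) (A : set R) (f : R -> R) :
  (forall s, A s -> derivable_within A f s) -> {within A, continuous f}.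
Proof.
move=> df; apply/subspace_continuousP => s As.
have fs := df s As.
have FF : Filter (within A s^') by exact: within_filter.
have lin : (t - s) @[t --> within A s^'] --> (s - s : R).
  apply: cvg_within_filter; apply: cvg_within_filter.
  by apply: cvgB; [exact: cvg_id|exact: cvg_cst].
have := cvgD (cvgM fs lin) (cvg_cst (f s)).
rewrite subrr mulr0 add0r => lim.
move=> P fP.
change (\forall t \near s, A t -> P (f t)).
have : \forall t \near s, t != s -> A t ->
  P ((f t - f s) / (t - s) * (t - s) + f s) := lim FF FF FF P fP.
apply: filterS => t Pt At.
have [->|ts] := eqVneq t s; first exact: nbhs_singleton fP.
by have := Pt ts At; rewrite divfK ?subr_eq0 // subrK.
Qed.

(** Away from the ends the restriction to the interval is invisible; this gives
    access to the mean value theorem. *)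
Lemma derive_within_interior (R : realType) (u v : R) (f : R -> R) (s : R) :
  s \in `]u, v[ -> derivable_within `[u, v] f s ->
  is_derive s 1 f (derive_within `[u, v] f s).
Proof.
move=> suv fs.
have cvgq : (f t - f s) / (t - s) @[t --> s^'] --> derive_within `[u, v] f s.
  move=> P LP.
  have : \forall t \near s, t != s -> `[u, v]%classic t ->
    P ((f t - f s) / (t - s)) := fs P LP.
  apply: filterS2 (near_in_itvoo suv) => t tuv + ts; apply => //.
  exact: subset_itv_oo_cc.
have cvgh : h^-1 *: ((f \o shift s) (h *: 1) - f s) @[h --> 0^']
    --> derive_within `[u, v] f s.
  move=> P LP.
  have : \forall t \near s, t != s -> P ((f t - f s) / (t - s)) := cvgq P LP.
  rewrite (near_shift 0) subr0 => sP.
  change (\forall h \near (0 : R), h != 0 ->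
    P (h^-1 * (f (h * 1 + s) - f s))).
  apply: filterS sP => h /= Ph h0.
  rewrite mulr1 mulrC -{2}(addrK s h); apply: Ph.
  by rewrite -subr_eq0 addrK.
by split; [apply/cvg_ex; eexists; exact: cvgh|exact: cvg_lim].
Qed.

(** * Convexity and tangent lines *)

(** The chord slope between [s] and [t] is the derivative at a point between
    them, so it exceeds the derivative at [s] if [s < t] and is below it if
    [t < s]; both times the chord lies above the tangent at [s]. *)
Lemma nondecreasing_derive_above_tangents (R : realType) (u v : R)
    (f : R -> R) :
  (forall s, s \in `[u, v] -> derivable_within `[u, v] f s) ->
  {in `[u, v] &, {homo derive_within `[u, v] f : s t / s <= t}} ->
  {in `[u, v] &, forall s t, f s + derive_within `[u, v] f s * (t - s) <= f t}.
Proof.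
move=> df mono s t suv tuv.
have cf : {within `[u, v], continuous f} by exact: derivable_within_continuous.
have mvt p q : p \in `[u, v] -> q \in `[u, v] -> p < q ->
    exists2 c, c \in `]p, q[ & f q - f p = derive_within `[u, v] f c * (q - p).
  rewrite !in_itv /= => /andP[up pv] /andP[uq qv] pq.
  apply: MVT => //.
    move=> c; rewrite in_itv /= => /andP[pc cq]; apply: derive_within_interior.
      by rewrite in_itv /= (le_lt_trans up pc) (lt_le_trans cq qv).
    by apply: df; rewrite in_itv /=; apply/andP; split; lra.
  apply: continuous_subspaceW cf => c /=; rewrite !in_itv /= => /andP[pc cq].
  by apply/andP; split; lra.
have [st|ts|->] := ltgtP s t; last by rewrite subrr mulr0 addr0.
- have [c cst E] := mvt s t suv tuv st.
  have : derive_within `[u, v] f s <= derive_within `[u, v] f c.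
    move: cst suv tuv; rewrite !in_itv /= => /andP[? ?] /andP[? ?] /andP[? ?].
    by apply: mono; rewrite ?in_itv /=; lra.
  by nra.
- have [c cst E] := mvt t s tuv suv ts.
  have : derive_within `[u, v] f c <= derive_within `[u, v] f s.
    move: cst suv tuv; rewrite !in_itv /= => /andP[? ?] /andP[? ?] /andP[? ?].
    by apply: mono; rewrite ?in_itv /=; lra.
  by nra.
Qed.

Lemma convex_functionP (R : realType) (u v : R) (f : R -> R) :
  convex_function (`[u, v] : set R^o) f <->
  forall s t l, s \in `[u, v] -> t \in `[u, v] -> 0 <= l <= 1 ->
    f (l * s + (1 - l) * t) <= l * f s + (1 - l) * f t.
Proof.
split=> [cf s t l suv tuv l01|cf l s t suv tuv].
  have := cf (Itv01 (proj1 (andP l01)) (proj2 (andP l01))) s t.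
  by rewrite !inE => /(_ suv tuv); rewrite !convRE.
rewrite !convRE; move: suv tuv; rewrite !inE => suv tuv.
by apply: cf => //; apply/andP; split.
Qed.

(** Only one supporting line per point is used, whatever its slope: average the
    inequalities at [s] and [t] for the line through their barycentre. *)
Lemma above_tangents_convex (R : realType) (u v : R) (f df : R -> R) :
  {in `[u, v] &, forall s t, f s + df s * (t - s) <= f t} ->
  convex_function (`[u, v] : set R^o) f.
Proof.
move=> tan; apply/convex_functionP => s t l suv tuv /andP[l0 l1].
set w := l * s + (1 - l) * t.
have wuv : w \in `[u, v].
  move: suv tuv; rewrite !in_itv /= => /andP[? ?] /andP[? ?].
  by apply/andP; split; rewrite /w; nra.
have sw := tan _ _ wuv suv; have tw := tan _ _ wuv tuv.
(* The slope terms cancel because [w] is the barycentre. *)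
have -> : f w = l * (f w + df w * (s - w)) + (1 - l) * (f w + df w * (t - w)).
  by rewrite /w; ring.
by apply: lerD; rewrite ler_wpM2l // subr_ge0.
Qed.

(** By convexity the difference quotients from [s] towards [t], multiplied by
    [t - s], are at most [f t - f s]; the limit towards [s] is the tangent. *)
Lemma convex_above_tangents (R : realType) (u v : R) (f : R -> R) (s t : R) :
  convex_function (`[u, v] : set R^o) f -> derivable_within `[u, v] f s ->
  s \in `[u, v] -> t \in `[u, v] ->
  f s + derive_within `[u, v] f s * (t - s) <= f t.
Proof.
move=> /convex_functionP cf fs suv tuv.
have [->|ts] := eqVneq t s; first by rewrite subrr mulr0 addr0.
have lim := cvg_comp _ _ (cvg_segment_within suv tuv ts) fs.
(* Multiplying by [t - s] avoids a case split on its sign. *)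
have limM : (f (s + h * (t - s)) - f s) / (s + h * (t - s) - s) * (t - s)
    @[h --> (0 : R)^'+] --> derive_within `[u, v] f s * (t - s).
  by apply: cvgM; [exact: lim|exact: cvg_cst].
rewrite -lerBrDl; apply: (ler_cvg_to limM (cvg_cst (f t - f s))).
near=> h.
have h0 : 0 < h by near: h; exact: nbhs_right_gt.
have h1 : h < 1 by near: h; exact: nbhs_right_lt.
have := cf t s h tuv suv; rewrite (ltW h0) (ltW h1) => /(_ isT) cfh.
rewrite (_ : h * t + _ = s + h * (t - s)) in cfh; last by ring.
rewrite /= [s + _ - s]addrAC subrr add0r invfM mulrA divfK ?subr_eq0 //.
by rewrite ler_pdivrMr //; nra.
Unshelve. all: by end_near. Qed.

(** * Dyadic subintervals *)

Lemma dyadic_subinterval_bounds (R : realType) (u v u' v' : R) :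
  u < v -> dyadic_subinterval u v u' v' -> [/\ u <= u', u' < v' & v' <= v].
Proof. by move=> uv; elim=> [|s t _ [? ? ?]|s t _ [? ? ?]]; split; lra. Qed.

Lemma dyadic_subinterval_trans (R : realType) (u v u' v' u'' v'' : R) :
  dyadic_subinterval u v u' v' -> dyadic_subinterval u' v' u'' v'' ->
  dyadic_subinterval u v u'' v''.
Proof.
move=> d; elim=> // s t _.
- exact: dyadic_left.
- exact: dyadic_right.
Qed.

Lemma ltr_mul_expn2 (R : realType) (x e : R) :
  0 < e -> exists k, x < e * 2 ^+ k.
Proof.
move=> e0; exists (Num.bound `|x / e|); rewrite mulrC -ltr_pdivrMr //.
apply: le_lt_trans (ler_norm _) _.
apply: lt_trans (archi_boundP (normr_ge0 _)) _.
rewrite -natrX ltr_nat; exact: ltn_expl.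
Qed.

(** Bisect repeatedly, always keeping a half that contains [s]. *)
Lemma dyadic_shrink (R : realType) (u v s e : R) :
  s \in `[u, v] -> 0 < e ->
  exists u' v',
    [/\ dyadic_subinterval u v u' v', s \in `[u', v'] & v' - u' < e].
Proof.
move=> suv e0.
suff shrink k : exists u' v', [/\ dyadic_subinterval u v u' v', s \in `[u', v']
    & (v' - u') * 2 ^+ k = v - u].
  have [k ek] := ltr_mul_expn2 (v - u) e0.
  have [u' [v' [d sd E]]] := shrink k; exists u', v'; split => //.
  by move: ek; rewrite -E ltr_pM2r // exprn_gt0.
elim: k => [|k [u' [v' [d sd E]]]].
  by exists u, v; split => //; [exact: dyadic_self|rewrite expr0 mulr1].
have E' : (v' - u') / 2 * 2 ^+ k.+1 = v - u by rewrite exprS -E; field.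
move: sd; rewrite in_itv /= => /andP[us sv].
have [sm|ms] := leP s ((u' + v') / 2).
- exists u', ((u' + v') / 2); split; first exact: dyadic_left.
    by rewrite in_itv /= us.
  by rewrite -E'; congr (_ * _); field.
- exists ((u' + v') / 2), v'; split; first exact: dyadic_right.
    by rewrite in_itv /= sv ltW.
  by rewrite -E'; congr (_ * _); field.
Qed.

(** Density of the dyadic points, in the form used below: a closed condition on
    a continuous function propagates from left ends of dyadic subintervals. *)
Lemma ge0_of_dyadic (R : realType) (u v : R) (F : R -> R) :
  u < v -> {within `[u, v], continuous F} ->
  (forall u' v', dyadic_subinterval u v u' v' -> 0 <= F u') ->
  {in `[u, v], forall s, 0 <= F s}.
Proof.
move=> uv /subspace_continuousP cF F0 s suv.
rewrite leNgt; apply/negP => Fs.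
have : \forall t \near s, t \in `[u, v] -> F t < 0.
  exact: cvgr_lt (cF s suv) 0 Fs.
move=> /nbhs_ballP[e /= e0 eP].
have [u' [v' [d]]] := dyadic_shrink suv e0.
rewrite in_itv /= => /andP[us sv] lt.
have [uu uv' vv] := dyadic_subinterval_bounds uv d.
have := F0 _ _ d; rewrite leNgt => /negP; apply; apply: eP.
  by rewrite /ball /= ger0_norm; lra.
by rewrite in_itv /=; lra.
Qed.

(** Bisect while both points lie in the same half. This stops, since the length
    of the interval eventually drops below [t - s]; the last midpoint is between
    the two points. *)
Lemma dyadic_separate (R : realType) (u v s t : R) :
  s \in `[u, v] -> t \in `[u, v] -> s < t ->
  exists u' v', [/\ dyadic_subinterval u v u' v', u' <= s, t <= v' &
    s <= (u' + v') / 2 <= t].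
Proof.
rewrite !in_itv /= => /andP[us sv] /andP[ut tv] st.
have [|k /ltW] := ltr_mul_expn2 (v - u) (_ : 0 < t - s); first by lra.
elim: k u v us sv ut tv => [|k IH] u v us sv ut tv.
  rewrite expr0 mulr1 => len; exists u, v; split => //; last by lra.
  exact: dyadic_self.
rewrite exprS => len.
have [mt|tm] := leP ((u + v) / 2) t; last first.
  have [|||||u' [v' [d ? ? ?]]] := IH u ((u + v) / 2); try lra.
  by exists u', v'; split => //; apply: dyadic_subinterval_trans d;
    apply/dyadic_left/dyadic_self.
have [sm|ms] := leP s ((u + v) / 2).
  by exists u, v; split => //; [exact: dyadic_self|rewrite sm].
have [|||||u' [v' [d ? ? ?]]] := IH ((u + v) / 2) v; try lra.
by exists u', v'; split => //; apply: dyadic_subinterval_trans d;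
  apply/dyadic_right/dyadic_self.
Qed.

(** Monotonicity at the midpoints confines [F] on every dyadic subinterval
    between its end values, first at dyadic points and then everywhere by
    density. Two arbitrary points are compared through a dyadic midpoint that
    separates them. *)
Lemma nondecreasing_of_dyadic (R : realType) (u v : R) (F : R -> R) :
  u < v -> {within `[u, v], continuous F} ->
  (forall u' v', dyadic_subinterval u v u' v' ->
    F u' <= F ((u' + v') / 2) <= F v') ->
  {in `[u, v] &, {homo F : s t / s <= t}}.
Proof.
move=> uv cF Fm.
have bnd u' v' s : dyadic_subinterval u v u' v' -> s \in `[u', v'] ->
    F u' <= F s <= F v'.
  move=> d suv; have [uu uv' vv] := dyadic_subinterval_bounds uv d.
  have ends u'' v'' : dyadic_subinterval u' v' u'' v'' ->
      F u' <= F u'' /\ F u'' <= F v'' <= F v'.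
    elim=> [|a b /(dyadic_subinterval_trans d)/Fm /andP[? ?] [? /andP[? ?]]
           |a b /(dyadic_subinterval_trans d)/Fm /andP[? ?] [? /andP[? ?]]].
    - by have /andP[? ?] := Fm _ _ d; lra.
    - by lra.
    - by lra.
  have cF' : {within `[u', v'], continuous F}.
    by apply: continuous_subspaceW cF => c /=; rewrite !in_itv /=; lra.
  rewrite -(subr_ge0 (F u')) -(subr_ge0 (F s)); apply/andP; split.
  - apply: (ge0_of_dyadic (F := fun t => F t - F u') uv') suv => [|a b dab].
      by move=> t; apply: cvgB; [exact: cF'|exact: cvg_cst].
    by have [? ?] := ends _ _ dab; lra.
  - apply: (ge0_of_dyadic (F := fun t => F v' - F t) uv') suv => [|a b dab].
      by move=> t; apply: cvgB; [exact: cvg_cst|exact: cF'].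
    by have [? ?] := ends _ _ dab; lra.
move=> s t suv tuv; rewrite le_eqVlt => /predU1P[->//|st].
have [u' [v' [d us tv sm]]] := dyadic_separate suv tuv st.
have [uu uv' vv] := dyadic_subinterval_bounds uv d.
have /andP[_ sF] : F u' <= F s <= F ((u' + v') / 2).
  by apply: bnd; [exact: dyadic_left|rewrite in_itv /=; lra].
have /andP[tF _] : F ((u' + v') / 2) <= F t <= F v'.
  by apply: bnd; [exact: dyadic_right|rewrite in_itv /=; lra].
exact: le_trans tF.
Qed.

(** * Convexity gaps under Merrien subdivision *)

Definition chord_slope (R : realType) (f : R -> R) (u v : R) : R :=
  (f v - f u) / (v - u).

(** Nonnegativity of the two gaps is the shape condition on the Hermite data of
    an interval: the chord slope stays at least [theta] times the increment of
    the derivative away from both end slopes. *)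
Definition left_gap (R : realType) (theta : R) (f df : R -> R) (u v : R) : R :=
  chord_slope f u v - df u - theta * (df v - df u).

Definition right_gap (R : realType) (theta : R) (f df : R -> R) (u v : R) : R :=
  df v - chord_slope f u v - theta * (df v - df u).

Lemma beta_of_thetaK (R : realType) (theta : R) :
  theta < 1 / 2 -> theta_of_beta (beta_of_theta theta) = theta.
Proof.
move=> lt; rewrite /theta_of_beta /beta_of_theta.
have neq : 1 - 2 * theta != 0 by rewrite gt_eqF //; lra.
have -> : - (2 * theta) / (1 - 2 * theta) - 1 = - (1 - 2 * theta)^-1 by field.
by field.
Qed.

(** The Merrien rules rewritten as increments of the derivative and as chord
    slopes of the halves. *)
Lemma merrien_midpoint (R : realType) (theta u v : R) (f : R -> R)
    (df := derive_within `[u, v] f) :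
  u < v -> theta < 1 / 2 -> merrien_space (beta_of_theta theta) u v f ->
  forall u' v', dyadic_subinterval u v u' v' ->
    let m := (u' + v') / 2 in
    [/\ (1 - 2 * theta) * (df m - df u') = left_gap theta f df u' v',
        (1 - 2 * theta) * (df v' - df m) = right_gap theta f df u' v',
        chord_slope f u' m =
          chord_slope f u' v' - theta * (df v' - df u') &
        chord_slope f m v' =
          chord_slope f u' v' + theta * (df v' - df u')].
Proof.
move=> uv th [_ fM] u' v' d m.
have [_ uv' _] := dyadic_subinterval_bounds uv d.
have /= := fM _ _ d; rewrite -/df -/m beta_of_thetaK // => -[fm dm].
have neq : 1 - 2 * theta != 0 by rewrite gt_eqF //; lra.
have neq' : v' - u' != 0 by rewrite gt_eqF //; lra.
have mu : m - u' = (v' - u') / 2 by rewrite /m; field.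
have vm : v' - m = (v' - u') / 2 by rewrite /m; field.
by split; rewrite /left_gap /right_gap /chord_slope ?mu ?vm ?fm ?dm; field;
  rewrite ?neq ?neq'.
Qed.

(** Each half inherits only the gap on its own side. On the left half, with
    [delta] the increment of the derivative there, the chord slope exceeds the
    left end slope by [(1 - 2 * theta) * delta], which gives the two gaps
    [(1 - 3 * theta) * delta] and [theta * delta]. *)
Lemma merrien_gap_halving (R : realType) (theta u v : R) (f : R -> R)
    (df := derive_within `[u, v] f) :
  u < v -> theta < 1 / 2 -> merrien_space (beta_of_theta theta) u v f ->
  forall u' v', dyadic_subinterval u v u' v' ->
    let m := (u' + v') / 2 in
    [/\ left_gap theta f df u' m =
          (1 - 3 * theta) / (1 - 2 * theta) * left_gap theta f df u' v',
        right_gap theta f df u' m =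
          theta / (1 - 2 * theta) * left_gap theta f df u' v',
        left_gap theta f df m v' =
          theta / (1 - 2 * theta) * right_gap theta f df u' v' &
        right_gap theta f df m v' =
          (1 - 3 * theta) / (1 - 2 * theta) * right_gap theta f df u' v'].
Proof.
move=> uv th fM u' v' d m.
have [dl dr cl cr] := merrien_midpoint uv th fM d.
have neq : 1 - 2 * theta != 0 by rewrite gt_eqF //; lra.
rewrite -[left_gap _ _ _ u' v']dl -[right_gap _ _ _ u' v']dr !mulrA !divfK //.
move: dl dr; rewrite /left_gap /right_gap cl cr -/m -/df => dl dr.
by split; lra.
Qed.

(** The gaps are the increments of the derivative over the two halves, so the
    tangents at the ends and at the midpoint suffice for necessity; conversely
    the recurrence keeps nonnegative gaps nonnegative at all scales. The bound
    [1/3] is where its coefficient [1 - 3 * theta] would change sign. *)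
Lemma merrien_convexP (R : realType) (theta u v : R) (f : R -> R)
    (df := derive_within `[u, v] f) :
  u < v -> 0 <= theta <= 1 / 3 -> merrien_space (beta_of_theta theta) u v f ->
  convex_function (`[u, v] : set R^o) f <->
  0 <= left_gap theta f df u v /\ 0 <= right_gap theta f df u v.
Proof.
move=> uv /andP[th0 th3] fM.
have th2 : theta < 1 / 2 by lra.
have [[fD dfC] _] := fM.
have uuv : u \in `[u, v] by rewrite in_itv /=; lra.
have vuv : v \in `[u, v] by rewrite in_itv /=; lra.
split=> [cf|gaps0].
  set m := (u + v) / 2.
  have muv : m \in `[u, v] by rewrite in_itv /= /m; lra.
  have [<- <- _ _] := merrien_midpoint uv th2 fM (dyadic_self u v).
  rewrite -/m -/df.
  have tan s t (suv : s \in `[u, v]) (tuv : t \in `[u, v]) :=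
    convex_above_tangents cf (fD s suv) suv tuv.
  (* Add the tangent inequality from [s] at [t] to the one from [t] at [s]. *)
  have incr s t : s \in `[u, v] -> t \in `[u, v] -> s < t -> df s <= df t.
    move=> suv tuv st; have := tan s t suv tuv; have := tan t s tuv suv.
    by rewrite -/df; nra.
  have um := incr u m uuv muv; have mv := incr m v muv vuv.
  by split; apply: mulr_ge0; rewrite ?subr_ge0 ?um ?mv // /m; lra.
have gap0 u' v' : dyadic_subinterval u v u' v' ->
    0 <= left_gap theta f df u' v' /\ 0 <= right_gap theta f df u' v'.
  have c0 : 0 <= theta / (1 - 2 * theta) by apply: divr_ge0; lra.
  have c1 : 0 <= (1 - 3 * theta) / (1 - 2 * theta) by apply: divr_ge0; lra.
  elim=> // s t d [lg rg];
    have [ll lr rl rr] := merrien_gap_halving uv th2 fM d.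
  - by rewrite ll lr; split; exact: mulr_ge0.
  - by rewrite rl rr; split; exact: mulr_ge0.
apply: (above_tangents_convex (df := df)).
apply: nondecreasing_derive_above_tangents => //.
apply: nondecreasing_of_dyadic => // u' v' d.
have [lg rg] := gap0 _ _ d.
have [dl dr _ _] := merrien_midpoint uv th2 fM d.
have p0 : 0 < 1 - 2 * theta by lra.
move: lg rg; rewrite -dl -dr !pmulr_rge0 // !subr_ge0 -/df => -> ->.
by [].
Qed.

(** * The quadratic case *)

(** Equal gaps mean that the chord slope is the mean of the end slopes, which is
    the compatibility condition for a single quadratic polynomial to match all
    four Hermite data. *)
Lemma merrien_quarter_quadratic (R : realType) (u v u' v' : R) (f : R -> R)
    (df := derive_within `[u, v] f) :
  u < v -> merrien_space (beta_of_theta (1 / 4)) u v f ->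
  dyadic_subinterval u v u' v' ->
  left_gap (1 / 4) f df u' v' = right_gap (1 / 4) f df u' v' ->
  exists q : {poly R}, (size q <= 3)%N /\ {in `[u', v'], forall t, f t = q.[t]}.
Proof.
move=> uv fM d E.
have th2 : 1 / 4 < 1 / 2 :> R by lra.
have [uu uv' vv] := dyadic_subinterval_bounds uv d.
have neq : v' - u' != 0 by rewrite gt_eqF //; lra.
(* [c] is half the constant second derivative; [b] and [a] fit the slope and
   the value at [u']. *)
pose c := (df v' - df u') / (2 * (v' - u')).
pose b := df u' - 2 * c * u'.
pose a := f u' - b * u' - c * u' ^+ 2.
pose q : {poly R} := Poly [:: a; b; c].
have qE t : q.[t] = a + b * t + c * t ^+ 2 by rewrite horner_Poly /=; ring.
have halve s t : dyadic_subinterval u' v' s t ->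
    f s = q.[s] -> f t = q.[t] ->
    df s = b + 2 * c * s -> df t = b + 2 * c * t ->
    f ((s + t) / 2) = q.[(s + t) / 2] /\
    df ((s + t) / 2) = b + 2 * c * ((s + t) / 2).
  move=> dst fs ft ds dt; have [_ st _] := dyadic_subinterval_bounds uv' dst.
  have neq' : t - s != 0 by rewrite gt_eqF //; lra.
  have [_ /(_ _ _ (dyadic_subinterval_trans d dst))] := fM.
  rewrite /= -/df beta_of_thetaK // fs ft ds dt !qE => -[-> ->].
  by split; field; rewrite ?neq'.
have agree s t : dyadic_subinterval u' v' s t ->
    [/\ f s = q.[s], f t = q.[t], df s = b + 2 * c * s & df t = b + 2 * c * t].
  elim=> [|{}s {}t dst IH|{}s {}t dst IH].
  - split; rewrite ?qE /a /b; try ring.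
      have chordE : f v' = f u' + (df u' + df v') / 2 * (v' - u').
        have chord : chord_slope f u' v' = (df u' + df v') / 2.
          by move: E; rewrite /left_gap /right_gap; lra.
        by rewrite -chord /chord_slope divfK // addrC subrK.
      by rewrite chordE /c; field.
    by rewrite /c; field.
  - have [fs ft ds dt] := IH; have [fm dm] := halve _ _ dst fs ft ds dt.
    by split=> //; rewrite ?fm ?dm.
  - have [fs ft ds dt] := IH; have [fm dm] := halve _ _ dst fs ft ds dt.
    by split=> //; rewrite ?fm ?dm.
exists q; split; first exact: size_Poly.
move=> s suv.
(* A nonpositive function that is nonnegative at dyadic points vanishes. *)
apply/eqP; rewrite -subr_eq0 -normr_eq0 eq_le normr_ge0 andbT -oppr_ge0.
apply: (ge0_of_dyadic (F := fun s => - `|f s - q.[s]|) uv') suv => [|s' t' dst].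
  have cf : {within `[u, v], continuous f}.
    by apply: derivable_within_continuous; case: fM => -[].
  have cf' : {within `[u', v'], continuous f}.
    by apply: continuous_subspaceW cf => t /=; rewrite !in_itv /=; lra.
  have cq : {within `[u', v'], continuous (horner q)}.
    by apply: continuous_subspaceT; exact: continuous_horner.
  move=> t; apply: cvgN; apply: cvg_norm.
  by apply: cvgB; [exact: cf'|exact: cq].
by have [-> _ _ _] := agree _ _ dst; rewrite subrr normr0 oppr0.
Qed.

Lemma merrien_quarter_quadratic_spline (R : realType) (u v : R) (f : R -> R) :
  u < v -> merrien_space (beta_of_theta (1 / 4)) u v f ->
  quadratic_spline u v f.
Proof.
move=> uv fM; split; first by case: fM.
have th2 : 1 / 4 < 1 / 2 :> R by lra.
have [ll lr rl rr] := merrien_gap_halving uv th2 fM (dyadic_self u v).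
have self := dyadic_self u v.
have [|q [q3 fq]] := merrien_quarter_quadratic uv fM (dyadic_left self).
  by rewrite ll lr; congr (_ * _); field.
have [|r [r3 fr]] := merrien_quarter_quadratic uv fM (dyadic_right self).
  by rewrite rl rr; congr (_ * _); field.
by exists q, r; split.
Qed.

(** * Shape-preserving interpolation *)

Lemma partition_subset (R : realType) (n : nat) (a b : R) (x : 'I_n.+1 -> R)
    (i : 'I_n) :
  is_partition a b x -> `[x (lnode i), x (rnode i)] `<=` `[a, b].
Proof.
move=> [xa xb incr] t.
have mono (j k : 'I_n.+1) : (j <= k)%N -> x j <= x k.
  case: j k => [j jn] [k kn] /=; elim: k kn => [|k IH] kn.
    by rewrite leqn0 => /eqP j0; rewrite le_eqVlt; apply/orP; left;
      apply/eqP; congr x; apply: val_inj.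
  rewrite leq_eqVlt => /predU1P[jk|jk].
    by rewrite le_eqVlt; apply/orP; left; apply/eqP; congr x; apply: val_inj.
  have kn' : (k < n.+1)%N by exact: ltn_trans kn.
  apply: le_trans (IH kn' jk) _.
  have lE : lnode (Ordinal (kn : (k < n)%N)) = Ordinal kn' by apply: val_inj.
  have rE : rnode (Ordinal (kn : (k < n)%N)) = Ordinal kn by apply: val_inj.
  by rewrite -lE -rE ltW.
have a_le : a <= x (lnode i) by rewrite -xa; exact: mono.
have le_b : x (rnode i) <= b by rewrite -xb; apply: mono; exact: leq_ord.
by rewrite /= !in_itv /=; lra.
Qed.

Theorem theorem4 (R : realType) (n : nat) (a b : R)
    (x y p : 'I_n.+1 -> R) (theta : 'I_n -> R) (g : R -> R)
    (n_ge1 : (1 <= n)%N)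
    (x_partition : is_partition a b x)
    (slope_between : forall i : 'I_n,
       p (lnode i) < slope x y i < p (rnode i))
    (theta_range : forall i : 'I_n, 0 < theta i <= 1 / 4)
    (g_GS2 : GS2 a b x (fun i => beta_of_theta (theta i)) g)
    (g_value : forall j : 'I_n.+1, g (x j) = y j)
    (g_deriv : forall j : 'I_n.+1, derive_within `[a, b] g (x j) = p j) :
  forall i : 'I_n,
  let xl := x (lnode i) in
  let xr := x (rnode i) in
  let pl := p (lnode i) in
  let pr := p (rnode i) in
  let tau := slope x y i in
  let convex_on_Ii := convex_function (`[xl, xr] : set R^o) g in
  (1 / 4 * (3 * pl + pr) <= tau <= 1 / 4 * (pl + 3 * pr) ->
     theta i = 1 / 4 -> convex_on_Ii /\ quadratic_spline xl xr g)
  /\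
  (~~ (1 / 4 * (3 * pl + pr) <= tau <= 1 / 4 * (pl + 3 * pr)) ->
     [/\ convex_on_Ii -> theta i < 1 / 4,
         pl < tau < 1 / 4 * (3 * pl + pr) ->
           (convex_on_Ii <-> theta i <= (tau - pl) / (pr - pl)),
         1 / 4 * (pl + 3 * pr) < tau < pr ->
           (convex_on_Ii <-> theta i <= (pr - tau) / (pr - pl)) &
         merrien_space (beta_of_theta (theta i)) xl xr g]).
Proof.
move=> i xl xr pl pr tau convex_on_Ii.
have [gC1 gM] := g_GS2; have {}gM := gM i.
have [_ _ incr] := x_partition.
have x_lt : xl < xr by exact: incr.
have sub := partition_subset (i := i) x_partition.
have xl_in : xl \in `[xl, xr] by rewrite in_itv /=; lra.
have xr_in : xr \in `[xl, xr] by rewrite in_itv /=; lra.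
have dxl : derive_within `[xl, xr] g xl = pl.
  rewrite /pl -g_deriv; apply: derive_within_subset => //.
  by apply: (proj1 gC1); exact: sub.
have dxr : derive_within `[xl, xr] g xr = pr.
  rewrite /pr -g_deriv; apply: derive_within_subset => //.
  by apply: (proj1 gC1); exact: sub.
have chord : chord_slope g xl xr = tau by rewrite /chord_slope !g_value.
have /andP[th0 th4] := theta_range i.
have /andP[pt tp] : pl < tau < pr by exact: slope_between.
have th3 : 0 <= theta i <= 1 / 3 by lra.
have := merrien_convexP x_lt th3 gM.
rewrite /left_gap /right_gap chord dxl dxr -/convex_on_Ii => convexP.
have pp : 0 < pr - pl by lra.
split=> [mid th|mid].
  split; last by apply: merrien_quarter_quadratic_spline => //; rewrite -th.
  by apply/convexP; rewrite th; lra.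
split=> //.
- move=> /convexP[lg rg]; rewrite lt_neqAle th4 andbT; apply/eqP => th.
  by case/negP: mid; rewrite th in lg rg; lra.
- move=> /andP[_ lt]; rewrite ler_pdivlMr // convexP.
  by split; [|move=> ?; split]; nra.
- move=> /andP[lt _]; rewrite ler_pdivlMr // convexP.
  by split; [|move=> ?; split]; nra.
Qed.
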